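(* Let $\mathbb{F}_q$ be a finite field with $q$ elements, let $c\in\mathbb{F}_q$, and let $A_2=\begin{pmatrix} c&1\\0&c\end{pmatrix}$. Let $\mathcal{D}_{A_2}(\mathbb{F}_q)=\{X\in M_2(\mathbb{F}_q)\mid XA_2X=A_2XA_2\}$. (1) If $c=0$, then $\mathcal{D}_{A_2}(\mathbb{F}_q)$ is of cardinality $2q^2-q$ and is a 2-dimensional affine variety consisting of two 2-dimensional irreducible components. (2) If $c\neq 0$, then $\mathcal{D}_{A_2}(\mathbb{F}_q)$ is a 1-dimensional affine variety consisting of two isolated points and one 1-dimensional irreducible component. In particular, $|\mathcal{D}_{A_2}(\mathbb{F}_q)|=q+2$.
   Context: $M_2(\mathbb{F}_q)$ is the space of $2\times 2$ matrices over $\mathbb{F}_q$. Let $R=\mathbb{F}_q[x_{11},x_{12},x_{21},x_{22}]$ be the polynomial ring. For $A\in M_2(\mathbb{F}_q)$ let $X=(x_{ij})$ be the generic matrix and let $I_A\subseteq R$ be the ideal generated by the four entries of $XAX-AXA$. The cardinality $|\mathcal{D}_A(\mathbb{F}_q)|$ is the number of matrices in $M_2(\mathbb{F}_q)$ satisfying $XAX=AXA$. The geometric statements about $\mathcal{D}_A(\mathbb{F}_q)$ as an affine variety refer to the closed subvariety $V(I_A)$ of affine 4-space over $\mathbb{F}_q$ defined by $I_A$: its irreducible components are the $V(\mathfrak{p})$ for $\mathfrak{p}$ a minimal prime ideal of $R$ over $I_A$; the dimension of $V(\mathfrak{p})$ is the Krull dimension of $R/\mathfrak{p}$; the dimension of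 the variety is the Krull dimension of $R/I_A$. An isolated point is a component $V(\mathfrak{m})$ with $\mathfrak{m}=\langle x_{ij}-m_{ij}\mid 1\le i,j\le 2\rangle$ for some matrix $(m_{ij})\in M_2(\mathbb{F}_q)$. ''Consisting of'' means that the listed objects are all the irreducible components. *)

(* Defs.v *)
From HB Require Import structures.
From mathcomp Require Import all_boot all_order all_algebra.
From mathcomp Require Import ring_quotient boolp mpoly.

Set Implicit Arguments.
Unset Strict Implicit.
Unset Printing Implicit Defensive.

Import GRing.Theory.
Local Open Scope ring_scope.

Notation ideal := Idealr.type.
Notation primeIdeal := PrimeIdealr.type.

Section Ideals.
Variable T : comNzRingType.

(* Ideals are boolean predicates bundled with proofs, so two of them are
   compared by inclusion or by extensional equality, not by Leibniz equality. *)
Definition ideal_sub (I J : {pred T}) : Prop := {subset I <= J}.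
Definition ideal_eq (I J : {pred T}) : Prop := I =i J.

Definition minimal_prime (I : ideal T) (p : primeIdeal T) : Prop :=
  ideal_sub I p /\
  forall p' : primeIdeal T, ideal_sub I p' -> ideal_sub p' p -> ideal_eq p' p.

Definition entry_ideal m n (G : 'M[T]_(m, n)) : {pred T} :=
  fun f => `[< exists C : 'M[T]_(m, n), f = \sum_i \sum_j C i j * G i j >].

Lemma entry_idealP m n (G : 'M[T]_(m, n)) f :
  reflect (exists C : 'M[T]_(m, n), f = \sum_i \sum_j C i j * G i j)
          (f \in entry_ideal G).
Proof. exact: asboolP. Qed.

Lemma entry_ideal_closed m n (G : 'M[T]_(m, n)) :
  1 \notin entry_ideal G -> idealr_closed (entry_ideal G).
Proof.
move=> G1; split=> //.
  apply/entry_idealP; exists 0; rewrite big1 // => i _.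
  by rewrite big1 // => j _; rewrite mxE mul0r.
move=> a u v /entry_idealP[C ->] /entry_idealP[D ->]; apply/entry_idealP.
exists (a *: C + D); rewrite mulr_sumr -big_split; apply: eq_bigr => i _ /=.
rewrite mulr_sumr -big_split; apply: eq_bigr => j _ /=.
by rewrite !mxE mulrDl mulrA.
Qed.

Definition prime_chain n (p : 'I_n.+1 -> primeIdeal T) : Prop :=
  forall i j : 'I_n.+1, (i < j)%N ->
    ideal_sub (p i) (p j) /\ ~ ideal_sub (p j) (p i).

(* [krull_dim d] says that the Krull dimension of [T] is finite, equal to [d]. *)
Definition krull_dim (d : nat) : Prop :=
  (exists p : 'I_d.+1 -> primeIdeal T, prime_chain p) /\
  forall n (p : 'I_n.+1 -> primeIdeal T), prime_chain p -> (n <= d)%N.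

End Ideals.

Section Equation.
Variable F : fieldType.

(* The coordinate [x_ij] is the variable whose index [mxvec_index i j]
   enumerates the pairs [(i, j)] in row-major order. *)
Definition generic_mx : 'M[{mpoly F[2 * 2]}]_2 :=
  \matrix_(i, j) 'X_(mxvec_index i j).

Definition const_poly_mx (M : 'M[F]_2) : 'M[{mpoly F[2 * 2]}]_2 :=
  map_mx (@mpolyC (2 * 2) F) M.

Definition equation_mx (A : 'M[F]_2) : 'M[{mpoly F[2 * 2]}]_2 :=
  let X := generic_mx in
  let A' := const_poly_mx A in
  X *m A' *m X - A' *m X *m A'.

Definition equation_pred (A : 'M[F]_2) : {pred {mpoly F[2 * 2]}} :=
  entry_ideal (equation_mx A).

(* The zero matrix is a solution, so the ideal is proper, as is required of the
   library's ideals. *)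
Lemma equation_pred_closed (A : 'M[F]_2) : idealr_closed (equation_pred A).
Proof.
apply: entry_ideal_closed; apply/negP => /entry_idealP[C].
move/(congr1 (meval (fun _ => 0 : F))); rewrite meval1 raddf_sum big1 /=.
  by move/eqP; rewrite oner_eq0.
have X0 : map_mx (meval (fun _ => 0 : F)) generic_mx = 0.
  by apply/matrixP=> i j; rewrite !mxE mevalXU.
have E0 : map_mx (meval (fun _ => 0 : F)) (equation_mx A) = 0.
  by rewrite map_mxB !map_mxM X0 mulmx0 mulmx0 mul0mx subr0.
move=> i _; rewrite raddf_sum big1 //= => j _; rewrite mevalM.
by move/matrixP: E0 => /(_ i j); rewrite !mxE => ->; rewrite mulr0.
Qed.

HB.instance Definition _ (A : 'M[F]_2) :=
  isIdealr.Build {mpoly F[2 * 2]} (equation_pred A) (equation_pred_closed A).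

Definition equation_ideal (A : 'M[F]_2) : ideal {mpoly F[2 * 2]} :=
  HB.pack_for (ideal {mpoly F[2 * 2]}) (equation_pred A).

(* The component [V(p)] of [V(I)] is represented by the minimal prime [p]. *)
Definition component_dim (p : primeIdeal {mpoly F[2 * 2]}) (d : nat) : Prop :=
  krull_dim {ideal_quot p} d.

Definition variety_dim (I : ideal {mpoly F[2 * 2]}) (d : nat) : Prop :=
  krull_dim {ideal_quot I} d.

Definition point_ideal (M : 'M[F]_2) : {pred {mpoly F[2 * 2]}} :=
  entry_ideal (generic_mx - const_poly_mx M).

Definition isolated_point (I : ideal {mpoly F[2 * 2]})
    (p : primeIdeal {mpoly F[2 * 2]}) : Prop :=
  minimal_prime I p /\ exists M : 'M[F]_2, ideal_eq p (point_ideal M).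

Definition A2 (c : F) : 'M[F]_2 :=
  \matrix_(i < 2, j < 2) (nth [::] [:: [:: c; 1]; [:: 0; c]] i)`_j.

End Equation.

Definition solutions (F : finFieldType) (A : 'M[F]_2) : {set 'M[F]_2} :=
  [set X : 'M[F]_2 | X *m A *m X == A *m X *m A].

(* Main.v *)
(** Write d for the lower left entry of X. Over an integral domain the four
    entries of XAX = AXA factor: for c = 0 they say d = 0 and x11 x22 = 0, and
    for c invertible they force X = 0, X = A, or the curve
    X(t) = (c + t, t^2/c^2; -c^2, c - t). Over F_q this counts the solutions;
    over the quotient of the polynomial ring by a prime p containing I_A it
    shows that p contains the kernel of one of the corresponding substitutions
    into a polynomial ring in n <= 2 variables. These kernels are pairwise
    incomparable primes, so they are the minimal primes.

    For the dimension of F[x_1, ..., x_n], take a chain p_0 < ... < p_m of primes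
    and x_i in p_(i+1) outside p_i. Reducing modulo p_(i+1) and cancelling x_i
    shows that the monomials in the x_i are linearly independent modulo p_0. The
    N^m monomials with exponents below N have degree O(N), so they lie in a space
    of dimension O(N^n), whence m <= n. *)

Require Import Defs.
From HB Require Import structures.
From mathcomp Require Import all_boot all_order all_algebra.
From mathcomp Require Import ring_quotient boolp mpoly.
From mathcomp Require Import ring.

Set Implicit Arguments.
Unset Strict Implicit.
Unset Printing Implicit Defensive.

Import GRing.Theory.
Local Open Scope ring_scope.

(** * Prime ideals and their chains along a ring morphism *)

Section IdealTransfer.
Variables (R S : comNzRingType) (f : {rmorphism R -> S}).

Definition preim_ideal (p : {pred S}) : {pred R} := fun x => f x \in p.

Lemma in_preim_ideal (p : {pred S}) x :
  (x \in preim_ideal p) = (f x \in p).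
Proof. by []. Qed.

Lemma preim_ideal_closed (p : ideal S) : idealr_closed (preim_ideal p).
Proof.
split=> [||a u v]; rewrite !in_preim_ideal.
- by rewrite rmorph0 idealr0.
- by rewrite rmorph1 idealr1.
by move=> fu fv; rewrite rmorphD rmorphM rpredD // idealMr.
Qed.

HB.instance Definition _ (p : ideal S) :=
  isIdealr.Build R (preim_ideal p) (@preim_ideal_closed p).

Lemma preim_ideal_prime (p : primeIdeal S) :
  prime_idealr_closed (preim_ideal p).
Proof. by move=> u v; rewrite !in_preim_ideal rmorphM prime_idealrM. Qed.

HB.instance Definition _ (p : primeIdeal S) :=
  isPrimeIdealrClosed.Build R (preim_ideal p) (@preim_ideal_prime p).

Hypothesis f_surj : forall y, exists x, f x = y.

(** Since [p] contains the kernel of [f], membership of [x] in [p] depends only on [f x]. With [f]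
    onto, the direct image of [p] therefore inherits closure and primality. *)
Lemma image_ideal (p : primeIdeal R) :
  (forall x, f x = 0 -> x \in p) ->
  exists p' : primeIdeal S, forall x, (f x \in p') = (x \in p).
Proof.
move=> ker_p; pose P : {pred S} := fun y => `[< exists2 x, x \in p & f x = y >].
have PE x : (f x \in P) = (x \in p).
  apply/asboolP/idP => [[y py fE]|px]; last by exists x.
  by rewrite -(subrK y x) rpredD // ker_p // rmorphB fE subrr.
have Pc : idealr_closed P.
  split; first by rewrite -(rmorph0 f) PE idealr0.
    by rewrite -(rmorph1 f) PE idealr1.
  move=> a u v; have [[[x <-] [y <-]] [z <-]] := (f_surj a, f_surj u, f_surj v).
  by rewrite -rmorphM -rmorphD !PE => py pz; rewrite rpredD // idealMr.
have Pp : prime_idealr_closed P.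
  move=> u v; have [[x <-] [y <-]] := (f_surj u, f_surj v).
  by rewrite -rmorphM !PE prime_idealrM.
pose i1 := isIdealr.Build S P Pc.
pose i2 := isPrimeIdealrClosed.Build S P Pp.
by exists (HB.pack_for (primeIdeal S) P i1 i2).
Qed.

Lemma prime_chain_preim n (p : 'I_n.+1 -> primeIdeal S) :
  prime_chain p -> prime_chain (fun i => preim_ideal (p i) : primeIdeal R).
Proof.
move=> chp i j /chp[sub nsub]; split=> [x|sub']; first exact: sub.
by apply: nsub => y; have [x <-] := f_surj y => /sub'.
Qed.

Lemma prime_chain_image n (p : 'I_n.+1 -> primeIdeal R) :
  (forall x, f x = 0 -> x \in p ord0) -> prime_chain p ->
  exists p' : 'I_n.+1 -> primeIdeal S, prime_chain p'.
Proof.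
move=> ker_p chp.
have ker i x : f x = 0 -> x \in p i.
  move=> /ker_p; have [->//|i0] := eqVneq i ord0.
  by apply: (chp ord0 i _).1; rewrite lt0n.
have [p' p'E] := choice (fun i => image_ideal (@ker i)).
exists p' => i j /chp[sub nsub]; split=> [y|sub'].
  by have [x <-] := f_surj y; rewrite !p'E => /sub.
by apply: nsub => x; rewrite -!p'E => /sub'.
Qed.

End IdealTransfer.

(** * Kernels of morphisms into integral domains, as prime ideals *)

Section ZeroIdeal.
Variable S : idomainType.

Definition zero_ideal : {pred S} := fun x => x == 0.

Lemma in_zero_ideal x : (x \in zero_ideal) = (x == 0).
Proof. by []. Qed.

Lemma zero_ideal_closed : idealr_closed zero_ideal.
Proof.
split=> [||a u v]; rewrite !in_zero_ideal ?eqxx ?oner_eq0 // => /eqP-> /eqP->.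
by rewrite mulr0 addr0.
Qed.

HB.instance Definition _ := isIdealr.Build S zero_ideal zero_ideal_closed.

Lemma zero_ideal_prime : prime_idealr_closed zero_ideal.
Proof. by move=> u v; rewrite !in_zero_ideal mulf_eq0. Qed.

HB.instance Definition _ :=
  isPrimeIdealrClosed.Build S zero_ideal zero_ideal_prime.

End ZeroIdeal.

Definition ker_ideal (R : comNzRingType) (S : idomainType)
    (f : {rmorphism R -> S}) : primeIdeal R :=
  preim_ideal f (@zero_ideal S).

Lemma in_ker_ideal (R : comNzRingType) (S : idomainType)
    (f : {rmorphism R -> S}) x :
  (x \in ker_ideal f) = (f x == 0).
Proof. by []. Qed.

(** * Krull dimension of quotients, and families of minimal primes *)

Section QuotientDim.
Variables (R : comNzRingType) (I : ideal R).

Lemma pi_surj (y : {ideal_quot I}) : exists x, \pi_{ideal_quot I}%qT x = y.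
Proof. by exists (repr y); rewrite reprK. Qed.

Lemma pi_eq0 x : (\pi_{ideal_quot I}%qT x = 0) <-> x \in I.
Proof.
rewrite -{2}[x]subr0 Quotient.idealrBE -(rmorph0 \pi_{ideal_quot I}%qT).
by split=> /eqP.
Qed.

Lemma krull_dim_quot d :
  (exists p : 'I_d.+1 -> primeIdeal R, ideal_sub I (p ord0) /\ prime_chain p) ->
  (forall n (p : 'I_n.+1 -> primeIdeal R),
     ideal_sub I (p ord0) -> prime_chain p -> (n <= d)%N) ->
  krull_dim {ideal_quot I} d.
Proof.
move=> [p [Ip chp]] ub; split.
  by apply: prime_chain_image chp; [apply: pi_surj | move=> x /pi_eq0/Ip].
move=> n q /(prime_chain_preim pi_surj); apply: ub => x /pi_eq0 x0.
by rewrite in_preim_ideal /= x0 idealr0.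
Qed.

(** The first isomorphism theorem at the level of chains: those of the quotient and those of [S]
    both correspond to chains of primes of [R] above [I], so no isomorphism has to be built. *)
Lemma krull_dim_kernel (S : comNzRingType) (f : {rmorphism R -> S}) d :
  (forall y, exists x, f x = y) -> (forall x, x \in I <-> f x = 0) ->
  krull_dim S d -> krull_dim {ideal_quot I} d.
Proof.
move=> f_surj kerE [[p chp] ub]; apply: krull_dim_quot.
  exists (fun i => preim_ideal f (p i) : primeIdeal R); split; last exact: prime_chain_preim.
  by move=> x /kerE x0; rewrite in_preim_ideal /= x0 idealr0.
move=> n q Iq /(prime_chain_image f_surj)[x /kerE/Iq //|q']; exact: ub.
Qed.

End QuotientDim.

(** A prime minimal over [I] contains some [q k], hence equals it. Conversely, a prime between [I]
    and [q k] contains some [q l], and incomparability forces [l = k]. *)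
Lemma minimal_prime_family (R : comNzRingType) (I : ideal R) (K : Type)
    (q : K -> primeIdeal R) :
  (forall k, ideal_sub I (q k)) ->
  (forall k l, ideal_sub (q k) (q l) -> k = l) ->
  (forall p : primeIdeal R, ideal_sub I p -> exists k, ideal_sub (q k) p) ->
  forall p : primeIdeal R,
    minimal_prime I p <-> exists k, ideal_eq p (q k).
Proof.
move=> Iq q_inj cover p; split=> [[/cover[k qp] minp]|[k pE]].
  by exists k => x; rewrite (minp _ (Iq k) qp).
split=> [x /Iq|p' Ip' p'p]; first by rewrite pE.
have [l qp'] := cover p' Ip'.
have lk : l = k by apply: q_inj => x /qp'/p'p; rewrite pE.
by subst l => x; apply/idP/idP => [/p'p //|]; rewrite pE => /qp'.
Qed.

(** * Krull dimension of polynomial rings over a field *)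

Section PolynomialDim.
Variables (F : fieldType) (n : nat).
Local Notation P := {mpoly F[n]}.

(** Linear independence over [F] of the classes of the [e i] modulo [p]. *)
Definition free_mod (p : {pred P}) (I : finType) (e : I -> P) : Prop :=
  forall c : I -> F, \sum_i c i *: e i \in p -> forall i, c i = 0.

(** Modulo [p1] a relation keeps only its terms of exponent 0, whose coefficients vanish by
    freeness. What remains is [x] times a shorter relation, and [x] can be cancelled because [p0] is
    prime and does not contain it. *)
Lemma free_mod_powers (p0 p1 : primeIdeal P) (x : P) (I : finType) (e : I -> P)
    N :
  ideal_sub p0 p1 -> x \in p1 -> x \notin p0 -> free_mod p1 e ->
  free_mod p0 (fun u : I * 'I_N => e u.1 * x ^+ u.2).
Proof.
move=> sub xp1 xp0 free_e c.
suff step (d : nat -> I -> F) :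
    \sum_(k < N) (\sum_i d k i *: e i) * x ^+ k \in p0 ->
    forall k, (k < N)%N -> forall i, d k i = 0.
  (* Extension by 0 from [N] on gives coefficients indexed by [nat], which the induction on [N] can
     shift. *)
  pose d k i := if insub k is Some k' then c (i, k') else 0.
  have dE (k : 'I_N) i : d k i = c (i, k) by rewrite /d valK.
  move=> c0 [i k]; rewrite -dE; apply: (step) (ltn_ord k) i.
  congr (_ \in p0): c0; apply/esym.
  under eq_bigr do rewrite mulr_suml.
  rewrite exchange_big pair_bigA; apply: eq_bigr => -[i' k'] _ /=.
  by rewrite -scalerAl dE.
elim: N {c} d => // N IHN d; rewrite big_ord_recl expr0 mulr1.
under [X in _ + X]eq_bigr => k _ do rewrite lift0 exprS mulrCA.
rewrite -mulr_sumr => s0.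
have d0 i : d 0%N i = 0.
  by apply: free_e i; have := sub _ s0; rewrite rpredDr // mulrC idealMr.
move: s0; rewrite big1 ?add0r => [|i _]; last by rewrite d0 scale0r.
rewrite prime_idealrM (negPf xp0) /= => /(IHN (fun k => d k.+1)) dS.
by case=> [_ //|k] /dS.
Qed.

(* The members of the family are the monomials of exponents less than [N] in
   elements [x_i] of [p (i+1)] outside [p i]. *)
Lemma prime_chain_free m (p : 'I_m.+1 -> primeIdeal P) :
  prime_chain p ->
  exists D, forall N, exists (I : finType) (e : I -> P),
    [/\ #|I| = (N ^ m)%N, free_mod (p ord0) e &
        forall i, (msize (e i) <= N * D + 1)%N].
Proof.
elim: m p => [|m IHm] p chp.
  exists 0%N => N; exists unit, (fun _ => 1); split; first by rewrite card_unit.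
    move=> c; rewrite (bigD1 tt) //= big1 ?addr0 => [c0 []|[] //].
    (* A nonzero constant in a prime ideal would put 1 in it. *)
    apply/eqP; apply: contraT => cn0.
    move/(idealMr ((c tt)^-1)%:MP): c0.
    by rewrite mul_mpolyC scalerA mulVf // scale1r idealr1.
  by rewrite msize1 muln0.
have [|D HD] := IHm (fun i => p (lift ord0 i)).
  by move=> i j ij; apply: chp.
have [sub nsub] : ideal_sub (p ord0) (p (lift ord0 ord0)) /\
   ~ ideal_sub (p (lift ord0 ord0)) (p ord0) by apply: chp.
have [x xp1 xp0] : exists2 x, x \in p (lift ord0 ord0) & x \notin p ord0.
  apply: contrapT => nex; apply: nsub => x xp1.
  by apply: contraT => xp0; case: nex; exists x.
(* Each factor [x] raises the size by at most [(msize x).+1], and fewer than [N] of them occur. *)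
exists (D + (msize x).+1)%N => N; have [I [e [cI free_e le_e]]] := HD N.
exists (I * 'I_N)%type, (fun u : I * 'I_N => e u.1 * x ^+ u.2); split.
- by rewrite card_prod cI card_ord expnSr.
- exact: free_mod_powers free_e.
move=> [i [k ltkN]] /=.
have le_k : (msize (e i * x ^+ k) <= N * D + 1 + k * (msize x).+1)%N.
  elim: k {ltkN} => [|k IHk]; first by rewrite expr0 mulr1 mul0n addn0.
  rewrite exprSr mulrA (leq_trans (msizeM_le _ _)) // mulSn -addnS addnCA addnC.
  by rewrite leq_add2l.
rewrite (leq_trans le_k) // mulnDr addnAC leq_add2r leq_add2l leq_mul2r.
by rewrite ltnW ?orbT.
Qed.

Lemma card_bmultinom_le M : (#|{: 'X_{1..n < M}}| <= M ^ n)%N.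
Proof.
have le_m (m : 'X_{1..n < M}) (i : 'I_n) : (m i < M)%N.
  by apply: leq_ltn_trans (bmdeg m); rewrite mdegE (bigD1 i) //= leq_addr.
pose g (m : 'X_{1..n < M}) := [ffun i => Ordinal (le_m m i)].
have -> : (M ^ n)%N = #|{ffun 'I_n -> 'I_M}| by rewrite card_ffun !card_ord.
apply: (leq_card g).
move=> m1 m2 /ffunP g12; apply/val_inj/mnmP => i.
by have := g12 i; rewrite !ffunE => -[].
Qed.

(** The coefficient matrix of the [e i] has independent rows, since a vanishing combination of them
    is the zero polynomial, which lies in [p]. It has one column for each monomial of degree below
    [M]. *)
Lemma free_mod_card (p : ideal P) (I : finType) (e : I -> P) M :
  free_mod p e -> (forall i, msize (e i) <= M)%N -> (#|I| <= M ^ n)%N.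
Proof.
move=> free_e le_e; apply: leq_trans (card_bmultinom_le M).
pose C := \matrix_(i < #|I|, m < #|{: 'X_{1..n < M}}|)
  (e (enum_val i))@_(enum_val m : 'X_{1..n < M}).
suff <- : \rank C = #|I| by apply: rank_leq_col.
apply/eqP; rewrite -[_ == _]/(row_free C) -kermx_eq0; apply/rowV0P => v.
move=> /sub_kermxP vC0; apply/rowP => i; rewrite mxE.
have := free_e (fun j => v 0 (enum_rank j)); rewrite -[i]enum_valK.
apply; rewrite (_ : \sum_i _ = 0) ?idealr0 //.
apply/mpolyP => m; rewrite mcoeff0 raddf_sum /=.
have [ltmM|leMm] := ltnP (mdeg m) M; last first.
  rewrite big1 // => j _; rewrite mcoeffZ memN_msupp_eq0 ?mulr0 //.
  exact/msize_mdeg_ge/(leq_trans (le_e j)).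
move/rowP/(_ (enum_rank (BMultinom ltmM))): vC0; rewrite !mxE => vC0.
rewrite -[RHS]vC0 (reindex (@enum_rank I)) /=; last by apply/onW_bij/enum_rank_bij.
by apply: eq_bigr => j _; rewrite mcoeffZ mxE !enum_rankK.
Qed.

Lemma prime_chain_le m (p : 'I_m.+1 -> primeIdeal P) :
  prime_chain p -> (m <= n)%N.
Proof.
move=> /prime_chain_free[D HD]; rewrite leqNgt; apply/negP => ltnm.
(* [N] exceeds [D.+1 ^ n], so (ND + 1)^n <= N^n (D + 1)^n < N^(n+1) <= N^m, against the bound on
   free families. *)
pose N := (D.+1 ^ n).+1; have [I [e [cI free_e le_e]]] := HD N.
have := free_mod_card free_e le_e; rewrite cI leqNgt => /negP; apply.
have le1 : ((N * D + 1) ^ n <= N ^ n * D.+1 ^ n)%N.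
  rewrite -expnMn; case: (posnP n) => [->|n0]; first by rewrite !expn0.
  by rewrite leq_exp2r // mulnS addnC leq_add2r.
apply: (leq_ltn_trans le1); apply: (@leq_trans (N ^ n.+1)).
  by rewrite expnSr ltn_pmul2l ?expn_gt0.
by rewrite leq_pexp2l.
Qed.

(** The kernel of this substitution is the ideal generated by the first [k] variables; for k = 0,
    ..., n these kernels form a chain of length n. *)
Definition kill_vars (k : nat) : n.-tuple P :=
  [tuple if (i < k)%N then 0 else 'X_i | i < n].

Lemma kill_varsX k i :
  'X_i \mPo kill_vars k = if (i < k)%N then 0 else 'X_i.
Proof. by rewrite comp_mpolyXU -tnth_nth tnth_mktuple. Qed.

Lemma kill_vars_comp k l (f : P) : (k <= l)%N ->
  (f \mPo kill_vars k) \mPo kill_vars l = f \mPo kill_vars l.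
Proof.
move=> lekl; elim/mpolyind: f => [|c m f _ _ IHf]; first by rewrite !comp_mpoly0.
rewrite !comp_mpolyD IHf !comp_mpolyZ !comp_mpolyX; congr (_ *: _ + _).
rewrite rmorph_prod; apply: eq_bigr => i _ /=; rewrite rmorphXn /= !tnth_mktuple.
case: ifP => [ltik|_]; last by rewrite kill_varsX.
by rewrite comp_mpoly0 (leq_trans ltik lekl).
Qed.

Lemma krull_dim_mpoly : krull_dim P n.
Proof.
split; last by move=> m p; apply: prime_chain_le.
(* The definition of [q] is hidden because deciding that [q i] and [q j] are
   not convertible takes minutes. *)
have [q qE] : exists q : nat -> primeIdeal P,
    forall k f, (f \in q k) = (f \mPo kill_vars k == 0).
  by exists (fun k => ker_ideal (comp_mpoly (kill_vars k))).
exists (fun k => q k) => i j ltij; split=> [f|].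
  rewrite !qE => /eqP f0.
  by rewrite -(kill_vars_comp _ (ltnW ltij)) f0 comp_mpoly0.
have ltin : (i < n)%N by apply: leq_trans ltij _; rewrite -ltnS.
move=> /(_ 'X_(Ordinal ltin)); rewrite !qE !kill_varsX ltij ltnn eqxx.
by move=> /(_ isT); rewrite -msize_poly_eq0 msizeX.
Qed.

End PolynomialDim.

(** * Two-by-two matrices by entries, in the same form as [A2] *)

Definition mx2 (S : nzRingType) (x y z w : S) : 'M[S]_2 :=
  \matrix_(i < 2, j < 2) (nth [::] [:: [:: x; y]; [:: z; w]] i)`_j.

Lemma mx2E (S : nzRingType) (x y z w : S) :
  ((mx2 x y z w 0 0 = x) * (mx2 x y z w 0 1 = y) *
   (mx2 x y z w 1 0 = z) * (mx2 x y z w 1 1 = w))%type.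
Proof. by rewrite !mxE. Qed.

Lemma forall_ord2 (P : 'I_2 -> Prop) : P 0 -> P 1 -> forall i, P i.
Proof.
by move=> P0 P1 [[|[|//]] lti]; [move: P0 | move: P1]; congr P; apply: val_inj.
Qed.

Lemma eq_mx2 (S : nzRingType) (Y Z : 'M[S]_2) :
  Y 0 0 = Z 0 0 -> Y 0 1 = Z 0 1 -> Y 1 0 = Z 1 0 -> Y 1 1 = Z 1 1 -> Y = Z.
Proof.
move=> e00 e01 e10 e11; apply/matrixP.
by apply: forall_ord2; apply: forall_ord2.
Qed.

Lemma mx2_eta (S : nzRingType) (Y : 'M[S]_2) :
  Y = mx2 (Y 0 0) (Y 0 1) (Y 1 0) (Y 1 1).
Proof. by apply: eq_mx2; rewrite mx2E. Qed.

Lemma mx2_inj (S : nzRingType) (x y z w x' y' z' w' : S) :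
  mx2 x y z w = mx2 x' y' z' w' -> [/\ x = x', y = y', z = z' & w = w'].
Proof.
by move=> /matrixP eqM; split; move: (eqM 0 0) (eqM 0 1) (eqM 1 0) (eqM 1 1);
  rewrite !mx2E.
Qed.

Lemma map_mx2 (S S' : nzRingType) (f : {rmorphism S -> S'}) x y z w :
  map_mx f (mx2 x y z w) = mx2 (f x) (f y) (f z) (f w).
Proof. by apply: eq_mx2; rewrite mxE !mx2E. Qed.

Lemma mulmx2 (S : nzRingType) (x y z w x' y' z' w' : S) :
  mx2 x y z w *m mx2 x' y' z' w' =
  mx2 (x * x' + y * z') (x * y' + y * w') (z * x' + w * z') (z * y' + w * w').
Proof. by apply: eq_mx2; rewrite mxE !big_ord_recl big_ord0 addr0 !mxE. Qed.

(** * Solutions of the equation over an integral domain *)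

Section JordanEquation.
Variable S : comNzRingType.
(** Integrality is a hypothesis so that the solutions can be taken in [{ideal_quot p}], through
    [Quotient.rquot_IdomainAxiom], as well as in polynomial rings and fields. *)
Hypothesis S_domain : GRing.integral_domain_axiom S.

Lemma nilpotent_solutions (Y : 'M[S]_2) :
  let N := mx2 0 1 0 0 in
  Y *m N *m Y = N *m Y *m N <->
  (exists b e, Y = mx2 0 b 0 e) \/ (exists a b, Y = mx2 a b 0 0).
Proof.
move=> N; split=> [|[[b [e ->]]|[a [b ->]]]]; last 2 first.
- by rewrite !mulmx2; congr mx2; ring.
- by rewrite !mulmx2; congr mx2; ring.
rewrite [Y]mx2_eta; move: (Y 0 0) (Y 0 1) (Y 1 0) (Y 1 1) => a b d e.
rewrite !mulmx2 => /mx2_inj[_ E2 E3 _].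
(* The lower left entry of the equation reads d^2 = 0; the upper right one then reads a e = 0. *)
have d0 : d = 0.
  have /S_domain : d * d = 0 by move: E3; rewrite !Monoid.simpm.
  by rewrite orbb => /eqP.
have /S_domain/orP[/eqP->|/eqP->] : a * e = 0.
- by move: E2; rewrite d0 !Monoid.simpm.
- by left; exists b, e; rewrite d0.
- by right; exists a, b; rewrite d0.
Qed.

(** Certifies a consequence of one equation by its cofactor [k], leaving an identity for [ring]. *)
Lemma eq_of_multiple (k u v x y : S) : u = v -> x - y = k * (u - v) -> x = y.
Proof. by move=> ->; rewrite subrr mulr0 => /subr0_eq. Qed.

(** The lower left entry of the equation factors as d (d - (c^2 - ca - ce)) = 0: the first factor
    leads to the two points, the second to the curve. The inverse [k] is a parameter because [c]
    will also be the image of a constant in a polynomial or quotient ring. *)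
Lemma unit_jordan_solutions (c k : S) (Y : 'M[S]_2) :
  c * k = 1 -> let A := mx2 c 1 0 c in
  Y *m A *m Y = A *m Y *m A <->
  [\/ Y = mx2 0 0 0 0, Y = A |
      exists t, Y = mx2 (c + t) (k ^+ 2 * t ^+ 2) (- c ^+ 2) (c - t)].
Proof.
move=> ck A.
have ck2 x : c ^+ 2 * (k ^+ 2 * x) = x by rewrite mulrA -exprMn ck expr1n mul1r.
split=> [|[->|->|[t ->]]]; last 3 first.
- by rewrite !mulmx2; congr mx2; ring.
- by [].
- rewrite !mulmx2; set b := _ * t ^+ 2; have cb : c ^+ 2 * b = t ^+ 2 := ck2 _.
  congr mx2; last 2 first.
  + by ring.
  + by apply: (@eq_of_multiple (- c) _ _ _ _ cb); ring.
  + by apply: (@eq_of_multiple (- c) _ _ _ _ cb); ring.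
  by apply: (@eq_of_multiple 1 _ _ _ _ cb); ring.
have canc x y : c * x = c * y -> x = y.
  by move=> cxy; rewrite -[x]mul1r -[y]mul1r -ck -!mulrA !(mulrCA c) cxy.
rewrite [Y]mx2_eta; move: (Y 0 0) (Y 0 1) (Y 1 0) (Y 1 1) => a b d e.
rewrite !mulmx2 => /mx2_inj[E1 E2 E3 E4].
have /S_domain/orP[/eqP d0|/eqP/subr0_eq hd] :
    d * (d - (c ^+ 2 - c * a - c * e)) = 0.
- by apply: (@eq_of_multiple 1 _ _ _ _ E3); ring.
- rewrite d0 in E1 E2 E4.
  have /S_domain a01 : a * (a - c) = 0.
    by apply: canc; apply: (@eq_of_multiple 1 _ _ _ _ E1); ring.
  have /S_domain e01 : e * (e - c) = 0.
    by apply: canc; apply: (@eq_of_multiple 1 _ _ _ _ E4); ring.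
  (* When d = 0, each diagonal entry is 0 or c; if they differ, [E2] becomes c^2 = 0. *)
  have c2n0 : c ^+ 2 = 0 -> False.
    move=> c20; have := ck2 1; rewrite c20 mul0r => /esym/eqP.
    by rewrite oner_eq0.
  case/orP: a01 => [/eqP a0|/eqP/subr0_eq a0];
    case/orP: e01 => [/eqP e0|/eqP/subr0_eq e0]; rewrite a0 e0 in E2.
  + constructor 1; rewrite a0 e0 d0; congr mx2; do 2!apply: (canc).
    by apply: (@eq_of_multiple (- 1) _ _ _ _ E2); ring.
  + by case: c2n0; apply: (@eq_of_multiple (- 1) _ _ _ _ E2); ring.
  + by case: c2n0; apply: (@eq_of_multiple (- 1) _ _ _ _ E2); ring.
  constructor 2; rewrite a0 e0 d0; congr mx2; do 2!apply: (canc).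
  by apply: (@eq_of_multiple 1 _ _ _ _ E2); ring.
rewrite hd in E1 E2.
have Eb : b * (c ^+ 2 - c * a - c * e) = (c - a) * (c - e).
  by apply: canc; apply: (@eq_of_multiple 1 _ _ _ _ E1); ring.
(* Here [E2] amounts to ae - bd = c^2; adding [Eb] eliminates b and leaves c(a + e) = 2c^2. *)
have Ee : e = c - (a - c).
  apply: canc; move: (congr2 +%R E2 Eb) => E.
  by apply: (@eq_of_multiple 1 _ _ _ _ E); ring.
have Ed : d = - c ^+ 2 by rewrite hd Ee; ring.
constructor 3; exists (a - c); rewrite Ed Ee; congr mx2; first by ring.
rewrite -[b](ck2 b) -mulrCA; congr (_ * _); move: Eb; rewrite Ee => Eb.
by apply: (@eq_of_multiple (- 1) _ _ _ _ Eb); ring.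
Qed.

End JordanEquation.

(** * Ideals generated by matrix entries; dimension from components *)

Lemma entry_idealS (T : comNzRingType) m n (G : 'M[T]_(m, n)) (p : ideal T) :
  ideal_sub (entry_ideal G) p <-> forall i j, G i j \in p.
Proof.
split=> [Gp i j|Gp f /entry_idealP[C ->]]; last first.
  by do 2!apply: rpred_sum => ? _; apply: idealMr.
apply/Gp/entry_idealP; exists (delta_mx i j).
rewrite (bigD1 i) //= (bigD1 j) //= mxE !eqxx mul1r !big1 ?addr0 //.
  by move=> i' ni; rewrite big1 // => j' _; rewrite mxE (negPf ni) mul0r.
by move=> j' nj; rewrite mxE (negPf nj) andbF mul0r.
Qed.

(** A chain above [I] starts above some [q k], so all of it descends to the quotient by [q k]. *)
Lemma krull_dim_components (T : comNzRingType) (I : ideal T) (K : Type)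
    (q : K -> primeIdeal T) (dims : K -> nat) d :
  (forall k, ideal_sub I (q k)) ->
  (forall p : primeIdeal T, ideal_sub I p -> exists k, ideal_sub (q k) p) ->
  (forall k, krull_dim {ideal_quot q k} (dims k)) ->
  (forall k, dims k <= d)%N -> (exists k, dims k = d) ->
  krull_dim {ideal_quot I} d.
Proof.
move=> Iq cover dimq le_d [k0 k0d]; apply: krull_dim_quot.
  have [] := dimq k0; rewrite k0d => -[p /(prime_chain_preim (@pi_surj _ (q k0)))].
  move=> chp _; eexists; split; last exact: chp.
  move=> x /(Iq k0)/pi_eq0 x0.
  by rewrite in_preim_ideal /= x0 idealr0.
move=> n p /cover[k qp] chp; apply: leq_trans (le_d k).
have [p'|p' chp'] := prime_chain_image (@pi_surj _ (q k)) _ chp.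
  by move/pi_eq0/qp.
exact: (dimq k).2 chp'.
Qed.

(** * Prime ideals of polynomially parametrized varieties *)

Section Parametrization.
Variable F : fieldType.
Local Notation R := {mpoly F[2 * 2]}.

Definition subst_mx n (W : 'M[{mpoly F[n]}]_2) : (2 * 2).-tuple {mpoly F[n]} :=
  [tuple mxvec W 0 k | k < 2 * 2].

Lemma subst_mxX n (W : 'M[{mpoly F[n]}]_2) i j :
  'X_(mxvec_index i j) \mPo subst_mx W = W i j.
Proof. by rewrite comp_mpolyXU -tnth_nth tnth_mktuple mxvecE. Qed.

Lemma mpoly_rmorph_eq n (S : comNzRingType)
    (f g : {rmorphism {mpoly F[n]} -> S}) :
  (forall c, f c%:MP = g c%:MP) -> (forall i, f 'X_i = g 'X_i) -> f =1 g.
Proof.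
move=> eqC eqX; elim/mpolyind => [|c m p _ _ IHp]; first by rewrite !rmorph0.
rewrite !rmorphD IHp -mul_mpolyC !rmorphM eqC mpolyXE_id !rmorph_prod.
by congr (_ * _ + _); apply: eq_bigr => i _; rewrite !rmorphXn eqX.
Qed.

(** The tuple [s] recovers the parameters from the entries of [W], so substituting [W] is onto the
    polynomial ring in [n] variables, and the kernel is the required prime. If the generic matrix
    agrees modulo [p'] with [W] evaluated at [s], every f is congruent to its image under both
    substitutions, so [p'] contains the kernel. *)
Lemma param_prime n (W : 'M[{mpoly F[n]}]_2) (s : n.-tuple R) :
  (forall i, tnth s i \mPo subst_mx W = 'X_i) ->
  exists p : primeIdeal R,
  [/\ forall f, (f \in p) = (f \mPo subst_mx W == 0),
      component_dim p n &
      forall p' : ideal R,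
        (forall i j, 'X_(mxvec_index i j) - (W i j \mPo s) \in p') ->
        ideal_sub p p'].
Proof.
move=> sW; exists (ker_ideal (comp_mpoly (subst_mx W))).
split; first by move=> f.
  apply: (krull_dim_kernel (f := comp_mpoly (subst_mx W))).
  - move=> y; exists (y \mPo s).
    apply: (mpoly_rmorph_eq
      (f := comp_mpoly (subst_mx W) \o comp_mpoly s) (g := idfun)).
      by move=> c; rewrite /= !comp_mpolyC.
    by move=> i; rewrite /= comp_mpolyXU -tnth_nth sW.
  - by move=> x; rewrite in_ker_ideal; split=> /eqP.
  exact: krull_dim_mpoly.
move=> p' Xp' f; rewrite in_ker_ideal => /eqP f0; apply/pi_eq0.
rewrite (@mpoly_rmorph_eq (2 * 2) {ideal_quot p'} \pi_{ideal_quot p'}%qT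
  (\pi_{ideal_quot p'}%qT \o (comp_mpoly s \o comp_mpoly (subst_mx W)))).
- by rewrite /= f0 comp_mpoly0 rmorph0.
- by move=> c; rewrite /= !comp_mpolyC.
move=> k; case/mxvec_indexP: k => i j; rewrite /= subst_mxX.
by apply/eqP; rewrite -Quotient.idealrBE.
Qed.

End Parametrization.

(** * Ideals containing the equations, read as matrix solutions *)

Section JordanVariety.
Variable F : fieldType.
Local Notation R := {mpoly F[2 * 2]}.
Local Notation X := (generic_mx F).

(** The map [g] sends the generators to the entries of the equation at the image of the generic
    matrix. Any [g] with kernel [p] is allowed, to cover both substitutions and quotient maps. *)
Lemma equation_idealS (S : comNzRingType) (g : {rmorphism R -> S}) (c : F)
    (p : ideal R) :
  (forall f, f \in p <-> g f = 0) ->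
  let B := mx2 (g c%:MP) 1 0 (g c%:MP) in
  let Y := map_mx g X in
  ideal_sub (equation_ideal (A2 c)) p <-> Y *m B *m Y = B *m Y *m B.
Proof.
move=> pE B Y.
have -> : B = map_mx g (const_poly_mx (A2 c)).
  by apply: eq_mx2; rewrite !mxE /= ?mpolyC1 ?mpolyC0 ?rmorph1 ?rmorph0.
have eqE : map_mx g (equation_mx (A2 c)) = _ := map_mxB g _ _.
rewrite !map_mxM in eqE.
split=> [/entry_idealS sub|eqY].
  apply/subr0_eq; rewrite -eqE; apply/matrixP => i j.
  by rewrite [LHS]mxE [RHS]mxE; apply/pE/sub.
apply/entry_idealS => i j; apply/pE.
by move/matrixP/(_ i j): eqE; rewrite mxE => ->; rewrite -/B -/Y eqY subrr mxE.
Qed.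

Lemma equation_ideal_param n (W : 'M[{mpoly F[n]}]_2) (c : F) (p : ideal R) :
  (forall f, (f \in p) = (f \mPo subst_mx W == 0)) ->
  let B := mx2 c%:MP 1 0 c%:MP in
  ideal_sub (equation_ideal (A2 c)) p <-> W *m B *m W = B *m W *m B.
Proof.
move=> pE B.
have XW : map_mx (comp_mpoly (subst_mx W)) X = W.
  by apply/matrixP => i j; rewrite !mxE subst_mxX.
rewrite (equation_idealS (g := comp_mpoly (subst_mx W))); last first.
  by move=> f; rewrite pE; split=> /eqP.
by rewrite XW /= comp_mpolyC.
Qed.

Lemma equation_ideal_quot (c : F) (p : ideal R) :
  let g := \pi_{ideal_quot p}%qT in
  let B := mx2 (g c%:MP) 1 0 (g c%:MP) in
  let Y := map_mx g X in
  ideal_sub (equation_ideal (A2 c)) p <-> Y *m B *m Y = B *m Y *m B.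
Proof.
by apply: (@equation_idealS {ideal_quot p}) => f; split=> /pi_eq0.
Qed.

Lemma param_component n (W : 'M[{mpoly F[n]}]_2) (s : n.-tuple R) :
  (forall i, tnth s i \mPo subst_mx W = 'X_i) ->
  exists p : primeIdeal R,
  [/\ forall f, (f \in p) = (f \mPo subst_mx W == 0),
      component_dim p n &
      forall p' : ideal R,
        map_mx \pi_{ideal_quot p'}%qT X =
          map_mx \pi_{ideal_quot p'}%qT (map_mx (comp_mpoly s) W) ->
        ideal_sub p p'].
Proof.
move=> /param_prime[p [pE dimp minp]]; exists p; split=> // p' /matrixP eqX.
apply: minp => i j; rewrite Quotient.idealrBE.
by have := eqX i j; rewrite !mxE => ->.
Qed.

(** A point is a parametrization by zero variables. Its generators vanish at [M], so the point ideal
    lies in the kernel [p]; the minimality clause, applied to the point ideal itself, gives the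
    reverse inclusion. *)
Lemma point_component (M : 'M[F]_2) :
  exists p : primeIdeal R,
  [/\ forall f, (f \in p) = (f \mPo subst_mx (map_mx (@mpolyC 0 F) M) == 0),
      component_dim p 0,
      ideal_eq p (point_ideal M) &
      forall p' : ideal R,
        map_mx \pi_{ideal_quot p'}%qT X =
          map_mx \pi_{ideal_quot p'}%qT (const_poly_mx M) ->
        ideal_sub p p'].
Proof.
have [|p [pE dimp minp]] :=
  @param_component _ (map_mx (@mpolyC 0 F) M) [tuple]; first by case.
have MM : map_mx (comp_mpoly [tuple]) (map_mx (@mpolyC 0 F) M) =
    const_poly_mx M by apply/matrixP => i j; rewrite !mxE comp_mpolyC.
rewrite {}MM in minp; exists p; split=> //.
have Xp i j : (X - const_poly_mx M) i j \in p.
  by rewrite pE !mxE comp_mpolyB comp_mpolyC subst_mxX mxE subrr.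
have subp : ideal_sub (point_ideal M) p by apply/entry_idealS.
have cl : idealr_closed (point_ideal M).
  by apply: entry_ideal_closed; apply/negP => /subp; rewrite idealr1.
pose mi := isIdealr.Build R (point_ideal M) cl.
pose P : ideal R := HB.pack_for (ideal R) (point_ideal M) mi.
have pP : ideal_sub p P.
  apply: minp; apply/matrixP => i j.
  have /entry_idealS/(_ i j) : ideal_sub (point_ideal M) P by [].
  by rewrite !mxE Quotient.idealrBE => /eqP.
by move=> f; apply/idP/idP => [/pP|/subp].
Qed.


End JordanVariety.

(** * The minimal primes in the two cases *)

Lemma idomain_axiom (S : idomainType) : GRing.integral_domain_axiom S.
Proof. by move=> x y /eqP; rewrite mulf_eq0. Qed.

Section Components.
Variable F : fieldType.
Local Notation R := {mpoly F[2 * 2]}.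
Local Notation X := (generic_mx F).
Local Notation Xv i j := ('X_(mxvec_index (i : 'I_2) (j : 'I_2)) : R).

Lemma mpolyX_neq0 n (i : 'I_n) : ('X_i : {mpoly F[n]}) != 0.
Proof. by rewrite -msize_poly_eq0 msizeX. Qed.

Lemma nilpotent_components :
  exists q : bool -> primeIdeal R,
  [/\ forall b, ideal_sub (equation_ideal (A2 (0 : F))) (q b),
      forall b b', ideal_sub (q b) (q b') -> b = b',
      forall p : primeIdeal R, ideal_sub (equation_ideal (A2 (0 : F))) p ->
        exists b, ideal_sub (q b) p &
      forall b, component_dim (q b) 2].
Proof.
(* The planes where the first column, respectively the second row, vanishes; the tuples below read
   the parameters off the free entries. *)
pose W1 : 'M[{mpoly F[2]}]_2 := mx2 0 'X_0 0 'X_1.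
pose W2 : 'M[{mpoly F[2]}]_2 := mx2 'X_0 'X_1 0 0.
have [|q1 [q1E dim1 min1]] := @param_component _ _ W1 [tuple Xv 0 1; Xv 1 1].
  by apply: forall_ord2; rewrite subst_mxX mx2E.
have [|q2 [q2E dim2 min2]] := @param_component _ _ W2 [tuple Xv 0 0; Xv 0 1].
  by apply: forall_ord2; rewrite subst_mxX mx2E.
exists (fun b => if b then q1 else q2); split.
- case; apply/(equation_ideal_param _ (W := _)); [exact: q1E | | exact: q2E |];
    rewrite mpolyC0; apply/(nilpotent_solutions (@idomain_axiom _)).
    by left; exists 'X_0, 'X_1.
  by right; exists 'X_0, 'X_1.
(* Of the two ideals, only [q1] contains x11 and only [q2] contains x22. *)
- case; case=> // sub; [have := sub (Xv 0 0) | have := sub (Xv 1 1)];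
    rewrite q1E q2E !subst_mxX !mx2E eqxx (negPf (mpolyX_neq0 _)) => /(_ isT) //.
- move=> p /equation_ideal_quot; rewrite mpolyC0 rmorph0.
  move/(nilpotent_solutions (@Quotient.rquot_IdomainAxiom _ p)).
  case=> [[b [e Ye]]|[a [b Ye]]]; [exists true; apply: min1 | exists false; apply: min2];
    rewrite ?/W1 ?/W2 !map_mx2 !rmorph0 /= !comp_mpolyXU /= Ye;
    congr mx2; symmetry; move/matrixP: Ye => Ye;
    [move: (Ye 0 1) | move: (Ye 1 1) | move: (Ye 0 0) | move: (Ye 0 1)];
    by rewrite !mxE.
by case.
Qed.

Lemma unit_jordan_components (c : F) : c != 0 ->
  exists q : option bool -> primeIdeal R,
  [/\ forall k, ideal_sub (equation_ideal (A2 c)) (q k),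
      forall k l, ideal_sub (q k) (q l) -> k = l,
      forall p : primeIdeal R, ideal_sub (equation_ideal (A2 c)) p ->
        exists k, ideal_sub (q k) p,
      forall b, exists M : 'M[F]_2, ideal_eq (q (Some b)) (point_ideal M) &
      forall k, component_dim (q k) (if k is Some _ then 0 else 1)].
Proof.
move=> c0.
have ckP n : (c%:MP * (c^-1)%:MP = 1 :> {mpoly F[n]}).
  by rewrite -mpolyCM mulfV // mpolyC1.
pose W : 'M[{mpoly F[1]}]_2 :=
  mx2 (c%:MP + 'X_0) ((c^-1)%:MP ^+ 2 * 'X_0 ^+ 2)
      (- c%:MP ^+ 2) (c%:MP - 'X_0).
(* The upper left entry of [W] is c + t, so x11 - c recovers the parameter. *)
have [|p1 [p1E dimp1 minp1]] := @param_component _ _ W [tuple Xv 0 0 - c%:MP].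
  move=> i; rewrite (ord1 i) /=.
  by rewrite comp_mpolyB subst_mxX comp_mpolyC mx2E addrC addKr.
have [m1 [m1E dimm1 pt1 minm1]] := point_component (mx2 0 0 0 (0 : F)).
have [m2 [m2E dimm2 pt2 minm2]] := point_component (mx2 c 1 0 c).
exists (fun k => if k is Some b then if b then m1 else m2 else p1); split.
- have S_domain n := @idomain_axiom {mpoly F[n]}.
  case=> [[]|]; apply/(equation_ideal_param _ (W := _));
    [exact: m1E | | exact: m2E | | exact: p1E |];
    apply/(unit_jordan_solutions (S_domain _) _ (ckP _)).
  + by constructor 1; rewrite map_mx2 rmorph0.
  + by constructor 2; rewrite map_mx2 rmorph0 rmorph1.
  by constructor 3; exists 'X_0.
(* The entry x21 is 0 at both points and -c^2 on the curve, while x11 is 0 at one point and c at the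
   other; an inclusion would put the nonzero constant c^2 or c in a prime ideal. *)
- have c20 : c ^+ 2 != 0 by rewrite expf_neq0.
  have d1 : Xv 1 0 \in m1.
    by rewrite m1E subst_mxX mxE mx2E mpolyC0.
  have d2 : Xv 1 0 \in m2.
    by rewrite m2E subst_mxX mxE mx2E mpolyC0.
  have dp : Xv 1 0 + (c ^+ 2)%:MP \in p1.
    by rewrite p1E comp_mpolyD subst_mxX comp_mpolyC mx2E rmorphXn addNr.
  have cn (p : primeIdeal R) a : a != 0 -> a%:MP \notin p.
    move=> a0; apply/negP => /(idealMr (a^-1)%:MP).
    by rewrite -mpolyCM mulVf // mpolyC1 idealr1.
  have a1 : Xv 0 0 \in m1.
    by rewrite m1E subst_mxX mxE mx2E mpolyC0.
  have a2 : Xv 0 0 - c%:MP \in m2.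
    by rewrite m2E comp_mpolyB subst_mxX comp_mpolyC mxE mx2E subrr.
  have noinc1 (p : primeIdeal R) :
      Xv 1 0 \in p -> Xv 1 0 + (c ^+ 2)%:MP \in p -> False.
    by move=> dP; rewrite rpredDl // => cP; have := cn p _ c20; rewrite cP.
  have noinc2 (p : primeIdeal R) :
      Xv 0 0 \in p -> Xv 0 0 - c%:MP \in p -> False.
    by move=> aP; rewrite rpredDl // rpredN => cP; have := cn p _ c0; rewrite cP.
  case=> [[]|] [[]|] //= sub; exfalso.
  + by apply: (noinc2 m2) => //; apply: sub.
  + by apply: (noinc1 p1) => //; apply: sub.
  + by apply: (noinc2 m1) => //; apply: sub.
  + by apply: (noinc1 p1) => //; apply: sub.
  + by apply: (noinc1 m1) => //; apply: sub.
  + by apply: (noinc1 m2) => //; apply: sub.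
- move=> p /equation_ideal_quot; set g := \pi_{ideal_quot p}%qT.
  have ckQ : g c%:MP * g (c^-1)%:MP = 1 by rewrite -rmorphM ckP rmorph1.
  move/(unit_jordan_solutions (@Quotient.rquot_IdomainAxiom _ p) _ ckQ).
  case=> [Ye|Ye|[t Ye]]; [exists (Some true); apply: minm1 |
    exists (Some false); apply: minm2 | exists None; apply: minp1]; rewrite Ye.
  + by rewrite /const_poly_mx !map_mx2 !rmorph0.
  + by rewrite /const_poly_mx !map_mx2 !rmorph0 !rmorph1.
  (* The parameter t lives in the quotient; the upper left entry shows that it is the class of x11 -
     c. *)
  have [u -> uE] : exists2 u, t = g u & u = Xv 0 0 - c%:MP.
    exists (Xv 0 0 - c%:MP) => //.
    have Yt : g (Xv 0 0) = g c%:MP + t by move/matrixP/(_ 0 0): Ye; rewrite !mxE.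
    by rewrite /g rmorphB [X in X - _]Yt addrC addKr.
  have -> : map_mx (comp_mpoly [tuple Xv 0 0 - c%:MP]) W =
      mx2 (c%:MP + u) ((c^-1)%:MP ^+ 2 * u ^+ 2) (- c%:MP ^+ 2) (c%:MP - u).
    rewrite map_mx2 /= comp_mpolyD comp_mpolyN comp_mpolyB !rmorphM /=.
    by rewrite !comp_mpolyC comp_mpolyXU uE.
  by rewrite map_mx2 rmorphD rmorphM rmorphB rmorphN !rmorphXn.
- by case; [exists (mx2 0 0 0 0) | exists (mx2 c 1 0 c)].
by case=> [[]|].
Qed.

End Components.

(** * Counting solutions over a finite field *)

Section Count.
Variable F : finFieldType.

Lemma card_solutions_nilpotent :
  #|solutions (A2 (0 : F))| = (2 * #|F| ^ 2 - #|F|)%N.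
Proof.
pose f (u : F * F) : 'M[F]_2 := mx2 0 u.1 0 u.2.
pose g (u : F * F) : 'M[F]_2 := mx2 u.1 u.2 0 0.
have f_inj : injective f.
  by move=> [a b] [a' b'] /mx2_inj[_ /= -> _ ->].
have g_inj : injective g.
  by move=> [a b] [a' b'] /mx2_inj[/= -> -> _ _].
have -> : solutions (A2 0) = [set f u | u : F * F] :|: [set g u | u : F * F].
  apply/setP => Y; rewrite !inE; apply/eqP/orP.
    case/(nilpotent_solutions (@idomain_axiom F)) => -[a [b ->]].
      by left; apply/imsetP; exists (a, b).
    by right; apply/imsetP; exists (a, b).
  move=> fg; apply/(nilpotent_solutions (@idomain_axiom F)).
  by case: fg => /imsetP[[a b] _ ->]; [left | right]; exists a, b.
have -> : (2 * #|F| ^ 2 - #|F| = #|F| ^ 2 + #|F| ^ 2 - #|F|)%N.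
  by rewrite mul2n addnn.
rewrite cardsU !card_imset // card_prod -mulnn; congr (_ - _)%N.
(* The two planes meet in the line where only the upper right entry is free, which has [#|F|]
   elements. *)
have h_inj : injective (fun b : F => mx2 0 b 0 0) by move=> b b' /mx2_inj[].
rewrite -(card_imset _ h_inj); apply: eq_card => Y; rewrite !inE.
apply/andP/imsetP => [[/imsetP[[b e] _ ->] /imsetP[u _]]|[b _ ->]].
  by move=> /mx2_inj[_ _ _ /= ->]; exists b.
by split; apply/imsetP; [exists (b, 0) | exists (0, b)].
Qed.

Lemma card_solutions_unit (c : F) : c != 0 ->
  #|solutions (A2 c)| = (#|F| + 2)%N.
Proof.
move=> c0; pose f (t : F) : 'M[F]_2 :=
  mx2 (c + t) (c^-1 ^+ 2 * t ^+ 2) (- c ^+ 2) (c - t).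
have f_inj : injective f by move=> t t' /mx2_inj[/addrI].
have solP := unit_jordan_solutions (@idomain_axiom F) _ (mulfV c0).
have -> : solutions (A2 c) = [set mx2 0 0 0 0; mx2 c 1 0 c] :|: [set f t | t : F].
  apply/setP => Y; rewrite !inE; apply/eqP/orP.
    case/solP => [->|->|[t ->]]; rewrite ?eqxx ?orbT; [by left | by left | right].
    by apply/imsetP; exists t.
  move=> h; apply/solP.
  case: h => [/orP[]/eqP|/imsetP[t _]] ->; [by constructor 1 | by constructor 2|].
  by constructor 3; exists t.
(* The nonzero lower left entry keeps the curve disjoint from both points. *)
have d0 : - c ^+ 2 <> 0 by move/eqP; rewrite oppr_eq0 expf_eq0 (negPf c0).
rewrite cardsU card_imset // (_ : _ :&: _ = set0).
  rewrite cards0 subn0 cards2 addnC; congr (_ + _.+1)%N.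
  by rewrite (_ : _ != _) //; apply/eqP => /mx2_inj[c00]; case/eqP: c0.
apply/setP => Y; rewrite !inE; apply/negP => /andP[h /imsetP[t _ Ye]].
by move: h; rewrite {}Ye => /orP[]/eqP/mx2_inj[_ _ /d0].
Qed.

End Count.

(** * Components, dimensions and cardinalities assembled *)

Theorem theorem1p2 (F : finFieldType) (q : nat) (hq : #|F| = q) (c : F) :
  (c = 0 ->
     #|solutions (A2 c)| = (2 * q ^ 2 - q)%N
     /\ variety_dim (equation_ideal (A2 c)) 2
     /\ exists p1 p2 : primeIdeal {mpoly F[2 * 2]},
          ~ ideal_eq p1 p2
          /\ (forall p : primeIdeal {mpoly F[2 * 2]},
                minimal_prime (equation_ideal (A2 c)) p <->
                ideal_eq p p1 \/ ideal_eq p p2)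
          /\ component_dim p1 2
          /\ component_dim p2 2)
  /\
  (c <> 0 ->
     variety_dim (equation_ideal (A2 c)) 1
     /\ (exists m1 m2 p1 : primeIdeal {mpoly F[2 * 2]},
          (~ ideal_eq m1 m2 /\ ~ ideal_eq m1 p1 /\ ~ ideal_eq m2 p1)
          /\ (forall p : primeIdeal {mpoly F[2 * 2]},
                minimal_prime (equation_ideal (A2 c)) p <->
                ideal_eq p m1 \/ ideal_eq p m2 \/ ideal_eq p p1)
          /\ isolated_point (equation_ideal (A2 c)) m1
          /\ isolated_point (equation_ideal (A2 c)) m2
          /\ component_dim p1 1)
     /\ #|solutions (A2 c)| = (q + 2)%N).
Proof.
rewrite -hq; split=> [->|/eqP c0].
  have [q' [Iq q'_inj cover dimq]] := nilpotent_components F.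
  split; first exact: card_solutions_nilpotent.
  split.
    by apply: (krull_dim_components Iq cover dimq) => //; exists true.
  exists (q' true), (q' false); split.
    move=> eq_q; suff: true = false by [].
    by apply: q'_inj => f; rewrite eq_q.
  split; last by split; apply: dimq.
  move=> p; apply: (iff_trans (minimal_prime_family Iq q'_inj cover p)).
  by split=> [[[]]|[]]; [left | right | exists true | exists false].
have [q' [Iq q'_inj cover ptq dimq]] := unit_jordan_components c0.
have minE := minimal_prime_family Iq q'_inj cover.
have isol b : isolated_point (equation_ideal (A2 c)) (q' (Some b)).
  by split; [apply/minE; exists (Some b) | apply: ptq].
split.
  by apply: (krull_dim_components Iq cover dimq); [case | exists None].
split; last exact: card_solutions_unit.
exists (q' (Some true)), (q' (Some false)), (q' None); split.
  have neq k l : k <> l -> ~ ideal_eq (q' k) (q' l).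
    by move=> nkl eq_kl; apply/nkl/q'_inj => f; rewrite eq_kl.
  by split; [|split]; apply: neq.
split.
  move=> p; apply: (iff_trans (minE p)).
  split=> [[[[]|]]|[|[]]] pE; [left | right; left | right; right |
    exists (Some true) | exists (Some false) | exists None]; exact: pE.
by split; [|split; [|exact: dimq None]]; apply: isol.
Qed.
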